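(* Let $\{Y_t\}$ be the unique stationary solution $Y_t=\sum_{i\ge0}a_i\epsilon_{t-i}$ of $Y_t=\sum_{i=1}^d\phi_iY_{t-i}+\epsilon_t$, with $1-\sum_i\phi_iz^i$ having roots outside the closed unit disk and iid innovations having a Lebesgue density and a finite $\delta$-moment for some $\delta>0$, $\epsilon_t$ independent of $\sigma\{Y_s,s\le t-1\}$. Fix $h\ge1$, $p\in(0,1)$, and suppose $Y_t,\dots,Y_{t-n+1}$ ($n\ge d$) are observed. Let $\widehat\phi=\widehat\phi(n)$ be an estimator of $\phi$ with $\widehat\phi\to\phi$ in probability as $n\to\infty$. With $\Phi=(\phi\ e_1\cdots e_{d-1})$, $\widehat\Phi=(\widehat\phi\ e_1\cdots e_{d-1})$, set $\phi(h)=\Phi^he_1$, $\widehat\phi(h)=\widehat\Phi^he_1$, $Z_{t-k}=Y_{(t-k):(t-k-d+1)}=(Y_{t-k},\dots,Y_{t-k-d+1})^\top$, $\widehat Y_{t+h}(\phi)=\phi(h)^\top Z_t$, $\widehat Y_{t+h}(\widehat\phi)=\widehat\phi(h)^\top Z_t$, and \[ \widehat U_{t+h}=\frac{1}{n-d+1}\sum_{k=0}^{n-d}\mathbb{I}\big(\widehat\phi(h)^\top Z_{t-k}\le \widehat Y_{t+h}(\widehat\phi)\big),\qquad U^*_{t+h}=\mathbb{P}_Z\big(\phi(h)^\top Z\le \widehat Y_{t+h}(\phi)\big), \] where $Z$ has the same distribution as $Z_t$ and is independent of $(Z_t,\widehat\phi)$, and $\mathbb{P}_Z$ denotes probability with respect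 to $Z$ only. Suppose $\widehat Y_{t+h}(\phi)$ has a density with respect to Lebesgue measure and the marginal CDF $F_Y$ of $Y_t$ is continuous at $F_Y^{\leftarrow}(p)$. Then, as $n\to\infty$: (i) $\mathbb{P}[\widehat U_{t+h}\ge p]\to 1-p=\mathbb{P}[Y_{t+h}\ge F_Y^{\leftarrow}(p)]$; (ii) $\mathbb{P}(Y_{t+h}\ge F_Y^{\leftarrow}(p)\mid \widehat U_{t+h}\ge p)\to \mathbb{P}(Y_{t+h}\ge F_Y^{\leftarrow}(p)\mid U^*_{t+h}\ge p)$.
   Context: $F_Y^{\leftarrow}(p)=\inf\{y:F_Y(y)\ge p\}$; $e_1,\dots,e_{d-1}$ are the first standard basis vectors of $\mathbb{R}^d$. *)

(* Defs.v *)
From HB Require Import structures.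
From mathcomp Require Import all_boot all_order all_algebra.
From mathcomp Require Import all_classical all_reals all_analysis measurable_realfun.
From mathcomp Require Import complex.
Set Implicit Arguments. Unset Strict Implicit. Unset Printing Implicit Defensive.
Import Order.TTheory GRing.Theory Num.Theory.
Import numFieldNormedType.Exports.
Local Open Scope classical_set_scope.
Local Open Scope ring_scope.

Section AR.
Variables (R : realType) (dd : measure_display) (T : measurableType dd).
Variable (P : probability T R).

Definition gen_sigma (I : Type) (S : set I) (X : I -> T -> R) : set (set T) :=
  <<s [set X s @^-1` C | s in S & C in [set C : set R | measurable C]] >>.

Definition indep_of_sigma (X : T -> R) (G : set (set T)) : Prop :=
  forall A B, measurable A -> G B ->
    P (X @^-1` A `&` B) = (P (X @^-1` A) * P B)%E.

Definition mutually_independent (I : eqType) (X : I -> T -> R) : Prop :=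
  forall (J : seq I) (A : I -> set R), uniq J -> (forall i, measurable (A i)) ->
    P (\bigcap_(i in [set i | i \in J]) (X i @^-1` A i)) =
    (\prod_(i <- J) P (X i @^-1` A i))%E.

Definition identically_distributed (I : Type) (X : I -> T -> R) (i0 : I) : Prop :=
  forall i A, measurable A -> P (X i @^-1` A) = P (X i0 @^-1` A).

Definition has_lebesgue_density (X : T -> R) : Prop :=
  exists f : R -> \bar R, measurable_fun (@setT R) f /\ (forall x, (0 <= f x)%E) /\
    forall A, measurable A ->
      P (X @^-1` A) = (\int[@lebesgue_measure R]_(x in A) f x)%E.

Definition marg_cdf (X : T -> R) (y : R) : R := fine (P [set w | X w <= y]).
Definition gen_inverse (F : R -> R) (p : R) : R := inf [set y | p <= F y].

Definition cond_prob (A B : set T) : R := fine (P (A `&` B)) / fine (P B).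

End AR.

Section Companion.
Variable (R : realType) (d : nat).

(* Phi = (phi e_1 ... e_{d-1}) : column 0 is phi, column j (j>=1) is e_j
   (standard basis vector with a 1 in row j-1, 0-indexed) *)
Definition companion (phi : 'cV[R]_d) : 'M[R]_d :=
  \matrix_(i < d, j < d) if (j : nat) == 0%N then phi i 0
                         else ((i.+1 == j)%N)%:R.

Definition e1 : 'cV[R]_d := \col_(i < d) ((i : nat) == 0%N)%:R.

Definition phi_h (phi : 'cV[R]_d) (h : nat) : 'cV[R]_d :=
  (companion phi ^+ h) *m e1.

(* coefficients a_i of 1/(1 - sum_{j=1}^d phi_j z^j) = sum_i a_i z^i:
   a_0 = 1, a_{n+1} = sum_{j=1}^d phi_j a_{n+1-j} (a_k = 0 for k < 0).
   arcoefs n = [:: a_n; a_{n-1}; ...; a_0] *)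
Fixpoint arcoefs (phi : 'cV[R]_d) (n : nat) : seq R :=
  match n with
  | 0%N => [:: 1]
  | n'.+1 => let s := arcoefs phi n' in
             (\sum_(j < d) phi j 0 * nth 0 s j) :: s
  end.
Definition ma_coef (phi : 'cV[R]_d) (i : nat) : R := head 0 (arcoefs phi i).

Definition ar_poly_eval (phi : 'cV[R]_d) (z : R[i]) : R[i] :=
  1 - \sum_(j < d) ((phi j 0)%:C)%C * z ^+ j.+1.

End Companion.

(* Main.v *)
(** The innovations eps_t, eps_{t-1}, ... form an i.i.d. path, on which the shift
   preserves the law and is mixing (exactly so on cylinders, hence on all events by
   a lambda-system argument).  Since Y_{t-k} is almost surely a fixed function of
   the k-fold shift of this path, a second-moment bound gives the weak law of large
   numbers for the indicators of {phi(h)^T Z_{t-k} <= b} and {|Z_{t-k}| <= M}.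
   On the event that phihat(h) is close to phi(h), the empirical rank is squeezed
   between the empirical frequencies at two nearby thresholds b, up to the few k
   with |Z_{t-k}| > M.  Hence {p <= Uhat} and {p <= U*} differ by an event of
   vanishing probability, and P(U* >= p) = 1 - p because phi(h)^T Z_t has no
   atoms. *)
Require Import Defs.
From HB Require Import structures.
From mathcomp Require Import all_boot all_order all_algebra.
From mathcomp Require Import all_classical all_reals all_analysis measurable_realfun.
From mathcomp Require Import complex.
From mathcomp Require Import zify ring lra.
Import Order.TTheory GRing.Theory Num.Theory.
Import numFieldNormedType.Exports.
Local Open Scope classical_set_scope.
Local Open Scope ring_scope.

Set Implicit Arguments.

(** The threshold in [Uhat] is random, comes from the same sample as the average, and its
    coefficients change with n, so no law of large numbers applies to [Uhat] directly. Only the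
    event {p <= [Uhat]} matters, however, not the value of [Uhat]. It therefore suffices to know the
    empirical frequencies at two deterministic thresholds, fixed before n: quantiles of phi(h)^T Z_t
    of level slightly below and slightly above p. The undecided band between the outer quantiles has
    small probability by the choice of levels. The error of the k-th projection is at most the
    coefficient error times the l1 norm of Z_{t-k}, which is not bounded in k; the cut-off M makes
    the bound uniform, at the price of the discarded indices. Since [Ustar] is F(phi(h)^T Z_t), with
    F the distribution function of phi(h)^T Z_t, its event is a half-line event. Both claims follow
    from one fact: P(A and {p <= [Uhat]}) tends to P(A and {p <= [Ustar]}) for every measurable A.
    The whole space gives (i), the event Y_{t+h} >= q gives the numerator in (ii), and the
    denominator tends to 1 - p > 0. *)

Definition cylinder (R : realType) : set (set (nat -> R)) :=
  [set B | exists A : nat -> set R, [/\ forall i, measurable (A i),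
     exists n, forall i, (n <= i)%N -> A i = setT &
     B = [set x | forall i, A i (x i)]]].

Notation path_space R := (g_sigma_algebraType (@cylinder R)).

Section probability_fine.
Variables (R : realType) (d : measure_display) (T : measurableType d).
Variable P : probability T R.

Lemma fine_probability_ge0 (A : set T) : 0 <= fine (P A).
Proof. exact: fine_ge0. Qed.

Lemma EFin_probability (A : set T) : measurable A -> (fine (P A))%:E = P A.
Proof. by move=> mA; rewrite fineK // fin_num_measure. Qed.

Lemma fine_probability_le1 (A : set T) : measurable A -> fine (P A) <= 1.
Proof. by move=> mA; rewrite -lee_fin EFin_probability // probability_le1. Qed.

Lemma le_fine_probability (A B : set T) : measurable A -> measurable B ->
  A `<=` B -> fine (P A) <= fine (P B).
Proof.
move=> mA mB AB; rewrite fine_le ?fin_num_measure // le_measure ?inE //.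
Qed.

Lemma fine_probabilityD (A B : set T) : measurable A -> measurable B ->
  B `<=` A -> fine (P (A `\` B)) = fine (P A) - fine (P B).
Proof.
move=> mA mB BA; rewrite measureD //; last by rewrite ltey_eq fin_num_measure.
by rewrite (setIidr BA) fineB // fin_num_measure.
Qed.

Lemma fine_probabilityU_le (A B : set T) : measurable A -> measurable B ->
  fine (P (A `|` B)) <= fine (P A) + fine (P B).
Proof.
move=> mA mB; rewrite -fineD ?fin_num_measure // fine_le ?fin_num_measure //.
- exact: measurableU.
- by rewrite fin_numD !fin_num_measure.
- exact: measureU2.
Qed.

End probability_fine.

Lemma cylinder_setI (R : realType) : setI_closed (@cylinder R).
Proof.
move=> _ _ [A [mA [n An] ->]] [B [mB [m Bm] ->]].
exists (fun i => A i `&` B i); split.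
- by move=> i; exact: measurableI.
- exists (maxn n m) => i; rewrite geq_max => /andP[ni mi].
  by rewrite An // Bm // setIT.
- apply/seteqP; split=> x /=.
    by move=> [Ax Bx] i; split.
  by move=> ABx; split=> i; have [] := ABx i.
Qed.

Lemma cylinder_setT (R : realType) : cylinder R setT.
Proof.
exists (fun=> setT); split => //; first by exists 0%N.
by apply/seteqP; split.
Qed.

Lemma measurable_coord (R : realType) (i : nat) :
  measurable_fun setT (fun x : path_space R => x i).
Proof.
move=> _ C mC; rewrite setTI; apply: sub_sigma_algebra.
exists (fun j => if j == i then C else setT); split.
- by move=> j; case: ifP.
- by exists i.+1 => j ij; rewrite gtn_eqF.
- apply/seteqP; split=> x /=.
    by move=> Cx j; case: eqP => // ->.
  by move=> /(_ i); rewrite eqxx.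
Qed.

Lemma measurable_to_path (R : realType) (d : measure_display)
    (T : measurableType d) (f : T -> path_space R) :
  (forall i, measurable_fun setT (fun w => f w i)) -> measurable_fun setT f.
Proof.
move=> mf; apply: (@measurability _ _ _ _ _ f (@cylinder R)) => //.
move=> _ [_ [A [mA _ ->]] <-]; rewrite setTI.
rewrite [X in measurable X](_ : _ = \bigcap_i ((fun w => f w i) @^-1` A i)).
  apply: bigcapT_measurable => i; rewrite -[X in measurable X]setTI.
  exact: mf.
by apply/seteqP; split=> w /= Aw i => [_|]; exact: Aw.
Qed.

Definition path_shift (R : realType) (k : nat) (x : path_space R) :
  path_space R := fun i => x (i + k)%N.

Lemma measurable_path_shift (R : realType) (k : nat) :
  measurable_fun setT (@path_shift R k).
Proof. by apply: measurable_to_path => i; exact: measurable_coord. Qed.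

(** * Invariance and mixing of the shift under a product law *)

Section product_law.
Variables (R : realType) (mu : probability (path_space R) R).
Variable nu : set R -> \bar R.
(** Any [n] beyond the support of [A] is allowed, so a product may be padded with factors for [setT]
    up to a chosen length and cut there. *)
Hypothesis mu_prod : forall (A : nat -> set R) (n : nat),
  (forall i, measurable (A i)) -> (forall i, (n <= i)%N -> A i = setT) ->
  mu [set x | forall i, A i (x i)] = (\prod_(0 <= i < n) nu (A i))%E.

Let shiftI k (B C : set (path_space R)) := (@path_shift R k @^-1` B) `&` C.

(** For [n <= k] the two events constrain disjoint blocks of coordinates: [C] those below [k], the
    shifted [A] those from [k] on. The intersection is again a cylinder, and its product splits at
    [k]. *)
Lemma shift_cylinder_indep (A C : nat -> set R) (n k : nat)
  (mA : forall i, measurable (A i)) (mC : forall i, measurable (C i)) :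
  (exists m, forall i, (m <= i)%N -> A i = setT) ->
  (forall i, (n <= i)%N -> C i = setT) -> (n <= k)%N ->
  mu (shiftI k [set x | forall i, A i (x i)] [set x | forall i, C i (x i)]) =
  (mu [set x | forall i, A i (x i)] * mu [set x | forall i, C i (x i)])%E.
Proof.
move=> [m Am] Cn nk.
have -> : shiftI k [set x | forall i, A i (x i)] [set x | forall i, C i (x i)]
   = [set x | forall i, (if (i < k)%N then C i else A (i - k)%N) (x i)].
  apply/seteqP; split => x /=.
    move=> [Ax Cx] i; case: ltnP => ik; first exact: Cx.
    by have := Ax (i - k)%N; rewrite /path_shift subnK.
  move=> H; split=> i.
    by have := H (i + k)%N; rewrite ltnNge leq_addl /= addnK.
  case: (ltnP i k) => ik; first by have := H i; rewrite ik.
  by rewrite Cn // (leq_trans nk).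
rewrite (@mu_prod (fun i => if (i < k)%N then C i else A (i - k)%N)
  (k + m)%N); first last.
- move=> i kmi; rewrite ltnNge (leq_trans _ kmi) ?leq_addr //= Am //.
  by rewrite leq_subRL // (leq_trans _ kmi) // leq_addr.
- by move=> i; case: ifP.
rewrite (@mu_prod A m) // (@mu_prod C k) //; last first.
  by move=> i ki; rewrite Cn // (leq_trans nk).
rewrite (@big_cat_nat _ _ _ k) //=; last by rewrite leq_addr.
rewrite muleC; congr (_ * _)%E.
  rewrite -{1}[k]add0n big_addn addKn; apply: eq_big_nat => i /andP[_ im].
  by rewrite ltnNge leq_addl /= addnK.
by apply: eq_big_nat => i /andP[_ ->].
Qed.

Lemma measurable_shiftI k (B C : set (path_space R)) :
  measurable B -> measurable C -> measurable (shiftI k B C).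
Proof.
move=> mB mC; apply: measurableI => //; rewrite -[X in measurable X]setTI.
exact: measurable_path_shift.
Qed.

(** With the cylinder fixed, both sides are finite measures in [B]. They agree on cylinders, a
    generating family closed under intersection, and hence everywhere. *)
Lemma shift_indep_cylinder (C : nat -> set R) (n k : nat)
    (B : set (path_space R)) :
  (forall i, measurable (C i)) ->
  (forall i, (n <= i)%N -> C i = setT) -> (n <= k)%N -> measurable B ->
  mu (shiftI k B [set x | forall i, C i (x i)]) =
  (mu B * mu [set x | forall i, C i (x i)])%E.
Proof.
move=> mC Cn nk mB; set D := [set x | _].
have mD : measurable (D : set (path_space R)).
  by apply: sub_sigma_algebra; exists C; split => //; exists n.
have muDge0 : 0 <= fine (mu D) by exact: fine_ge0.
pose pushf := [the {measure set (path_space R) -> \bar R} of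
  pushforward (mrestr mu mD) (@path_shift R k)].
pose m1 := pushf (@measurable_path_shift R k).
pose m2 : {measure set (path_space R) -> \bar R} := mscale (NngNum muDge0) mu.
have muD : mu D \is a fin_num by exact: fin_num_measure.
have m2E X : m2 X = (mu X * mu D)%E by rewrite muleC -[in RHS](fineK muD).
rewrite -m2E.
rewrite [LHS](_ : _ = m1 B) //.
apply: (@measure_unique _ _ (path_space R) (@cylinder R) (fun=> setT) erefl
  _ _ _ m1 m2) => //.
- exact: cylinder_setI.
- by move=> _; exact: cylinder_setT.
- by rewrite bigcup_const.
- move=> _ [A [mA Am ->]]; rewrite m2E.
  exact: (@shift_cylinder_indep A C n k).
- move=> _; rewrite /m1 /= /pushforward /mrestr preimage_setT setTI.
  by rewrite ltey_eq muD.
Qed.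

Lemma shift_invariant k (B : set (path_space R)) : measurable B ->
  mu (@path_shift R k @^-1` B) = mu B.
Proof.
move=> mB; have := @shift_indep_cylinder (fun=> setT) 0 k B.
rewrite (_ : [set x | _] = setT); last by apply/seteqP; split.
by rewrite /shiftI setIT probability_setT mule1; exact.
Qed.

(* The class of C satisfying the conclusion is a lambda-system, and for a
   cylinder C the two sides are equal as soon as k exceeds its length. *)
Lemma shift_mixing (B C : set (path_space R)) : measurable B -> measurable C ->
  (fun k => fine (mu (shiftI k B C))) @ \oo --> fine (mu B) * fine (mu C).
Proof.
move=> mB; pose pr X := fine (mu X).
pose H := [set D : set (path_space R) | measurable D /\
  (fun k => pr (shiftI k B D)) @ \oo --> pr B * pr D].
suff : <<s setT, @cylinder R >> `<=` H by move=> sH mC; have [] := sH C mC.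
apply: lambda_system_subset => //; first exact: cylinder_setI.
- split=> //.
  + split; first exact: measurableT.
    rewrite /pr probability_setT mulr1.
    under eq_fun do rewrite /shiftI setIT shift_invariant //.
    exact: cvg_cst.
  + move=> D E ED [mD cD] [mE cE]; split; first exact: measurableD.
    rewrite /pr fine_probabilityD // mulrBr.
    rewrite (_ : (fun k => _) =
        (fun k => pr (shiftI k B D) - pr (shiftI k B E))).
      exact: cvgB.
    apply/funext => k; rewrite -fine_probabilityD //.
    * congr (fine (mu _)); apply/seteqP; split=> x /=.
        by move=> [Bx [Dx nEx]]; split => // -[].
      by move=> [[Bx Dx] nEx]; split => //; split=> // Ex; apply: nEx.
    * exact: measurable_shiftI.
    * exact: measurable_shiftI.
    * by move=> x [Bx /ED].
  + change (ndseq_closed H) with (forall F : nat -> set (path_space R),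
      {homo F : n m / (n <= m)%N >-> (n <= m)%O} ->
      (forall n, H (F n)) -> H (\bigcup_n F n)).
    (* Replacing the union by a late [F n] changes the shifted intersection and the product each by
       at most mu(union) - mu([F n]), whatever [k] is. One [n] thus serves all [k], leaving three
       errors of e / 3. *)
    move=> F ndF HF; have mF n : measurable (F n) by case: (HF n).
    have mU : measurable (\bigcup_n F n) by exact: bigcupT_measurable.
    split => //; apply/cvgrPdist_le => e e0.
    have : (fun n => pr (F n)) @ \oo --> pr (\bigcup_n F n).
      apply: fine_cvg; rewrite EFin_probability //.
      exact: nondecreasing_cvg_mu.
    have e30 : 0 < e / 3 by rewrite divr_gt0.
    move/cvgrPdist_le => /(_ _ e30) [n _ /(_ n (leqnn n)) Fn].
    have FnU : F n `<=` \bigcup_n F n by move=> x Fx; exists n.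
    have prB1 : pr B <= 1 by exact: fine_probability_le1.
    have prB0 : 0 <= pr B by exact: fine_probability_ge0.
    have prFU := le_fine_probability mu (mF n) mU FnU.
    rewrite -/(pr _) -/(pr _) in prFU.
    rewrite ger0_norm ?subr_ge0 // in Fn.
    have [_ /cvgrPdist_le /(_ _ e30)] := HF n.
    apply: filterS => k; rewrite !ler_norml => /andP[h1 h2].
    have sub : shiftI k B (F n) `<=` shiftI k B (\bigcup_n F n).
      by move=> x [Bx Fx]; split=> //; exact: FnU.
    have mk1 := @measurable_shiftI k B _ mB (mF n).
    have mk2 := @measurable_shiftI k B _ mB mU.
    have le1 := le_fine_probability mu mk1 mk2 sub.
    have le2 : pr (shiftI k B (\bigcup_n F n)) - pr (shiftI k B (F n)) <=
               pr (\bigcup_n F n) - pr (F n).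
      rewrite -!fine_probabilityD //; apply: le_fine_probability.
      * exact: measurableD.
      * exact: measurableD.
      * by move=> x [[Bx Ux] nF]; split=> // Fx; apply: nF.
    rewrite -/(pr _) -/(pr _) in le1.
    have h3 : pr B * (pr (\bigcup_n F n) - pr (F n)) <= e / 3.
      by rewrite (le_trans _ Fn) // ler_piMl // subr_ge0.
    have h4 : 0 <= pr B * (pr (\bigcup_n F n) - pr (F n)).
      by rewrite mulr_ge0 // subr_ge0.
    rewrite mulrBr in h3 h4.
    by apply/andP; split; lra.
- move=> _ [E [mE [n En] ->]]; split.
    by apply: sub_sigma_algebra; exists E; split => //; exists n.
  apply: cvg_near_cst; near=> k.
  rewrite /pr (@shift_indep_cylinder E n k B) // ?fineM ?fin_num_measure //.
    by apply: sub_sigma_algebra; exists E; split => //; exists n.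
  by near: k; exact: nbhs_infty_ge.
Unshelve. all: by end_near. Qed.
End product_law.

(** * Second moments and the weak law for the shift *)

Section double_sums.
Variable R : realFieldType.

Lemma sum_ord_rev (F : nat -> R) (m : nat) :
  \sum_(k < m.+1) F (m - k)%N = \sum_(k < m.+1) F k.
Proof.
rewrite (reindex_inj rev_ord_inj) /=; apply: eq_bigr => i _.
by rewrite subSS subKn // -ltnS.
Qed.

(** The array is a symmetric Toeplitz matrix. Enlarging it by one index adds a last row and a last
    column, each bounded by the sum of the absolute lags; hence the factor 2 m. *)
Lemma double_sum_dist_le (a : nat -> nat -> R) (c : nat -> R) (m : nat) :
  (forall j k, a j k = a k j) -> (forall j k, (j <= k)%N -> a j k = c (k - j)%N) ->
  \sum_(j < m) \sum_(k < m) a j k <= 2 * m%:R * \sum_(l < m) `|c l|.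
Proof.
move=> sym_a ac; elim: m => [|m IHm]; first by rewrite !big_ord0 mulr0.
set A := \sum_(l < m.+1) `|c l|.
have leA (F : nat -> R) : (forall k, F k = c (m - k)%N) ->
    \sum_(k < m.+1) F k <= A.
  move=> FE; rewrite (eq_bigr (fun k : 'I_m.+1 => c (m - k)%N)); last by [].
  by rewrite sum_ord_rev; apply: ler_sum => i _; exact: ler_norm.
rewrite big_ord_recr /=.
under eq_bigr do rewrite big_ord_recr /=.
rewrite big_split /=.
have h1 : \sum_(k < m.+1) a m k <= A.
  rewrite (eq_bigr (fun k : 'I_m.+1 => c (m - k)%N)).
    by rewrite sum_ord_rev; apply: ler_sum => i _; exact: ler_norm.
  by move=> k _; rewrite sym_a ac // -ltnS.
have h2 : \sum_(k < m) a k m <= A.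
  rewrite (eq_bigr (fun k : 'I_m => c (m - k)%N)); last first.
    by move=> k _; rewrite ac // ltnW.
  apply: le_trans (_ : \sum_(k < m) `|c (m - k)%N| <= _).
    by apply: ler_sum => i _; exact: ler_norm.
  rewrite /A -(sum_ord_rev (fun l => `|c l|)) big_ord_recr /= lerDl.
  exact: normr_ge0.
have h3 : 2 * m%:R * \sum_(l < m) `|c l| <= 2 * m%:R * A.
  rewrite ler_wpM2l ?mulr_ge0 // /A big_ord_recr /= lerDl normr_ge0 //.
rewrite (_ : 2 * m.+1%:R * A = 2 * m%:R * A + A + A).
  by rewrite !lerD // (le_trans IHm).
by rewrite -natr1; ring.
Qed.
End double_sums.

Section second_moment.
Variables (R : realType) (d : measure_display) (T : measurableType d).
Variable P : probability T R.

(* The square is expanded so that every integrand is nonnegative, which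
   dispenses with integrability side conditions. *)
Lemma count_deviation_le (B : nat -> set T) (b eps : R) (m : nat) :
  (forall k, measurable (B k)) -> (forall k, fine (P (B k)) = b) -> 0 < eps ->
  fine (P [set w | eps < `|\sum_(k < m) \1_(B k) w - m%:R * b|]) <=
  eps ^- 2 * \sum_(j < m) \sum_(k < m) (fine (P (B j `&` B k)) - b ^+ 2).
Proof.
move=> mB PB eps0; pose X w := \sum_(k < m) (\1_(B k) w : R).
have b0 : 0 <= b by rewrite -(PB 0%N) fine_probability_ge0.
have mX : measurable_fun setT X.
  by apply: measurable_sum => k; exact: measurable_indic.
have X0 w : 0 <= X w by apply: sumr_ge0 => k _; rewrite indicE.
pose S w := X w - m%:R * b.
have mS : measurable_fun setT S by apply: measurable_funB.
have mS2 : measurable_fun setT (fun w => S w ^+ 2) by exact: measurable_funX.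
have mX2 : measurable_fun setT (fun w => X w ^+ 2) by exact: measurable_funX.
set D := [set w | _].
have mD : measurable D.
  rewrite (_ : D = (fun w => `|S w|) @^-1` `]eps, +oo[).
    rewrite -[X in measurable X]setTI.
    by apply: (measurableT_comp (@normr_measurable R setT) mS).
  by apply/seteqP; split => w /=; rewrite in_itv /= andbT.
have EX : (\int[P]_w (X w)%:E = (m%:R * b)%:E)%E.
  under eq_integral do rewrite /X -sumEFin.
  rewrite ge0_integral_sum //; last first.
    by move=> k; apply/measurable_EFinP; exact: measurable_indic.
  rewrite (eq_bigr (fun=> b%:E)).
    by rewrite sumEFin sumr_const card_ord mulr_natl.
  by move=> k _; rewrite integral_indic // setIT -(PB k) EFin_probability.
have EX2 : (\int[P]_w (X w ^+ 2)%:E =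
   (\sum_(j < m) \sum_(k < m) fine (P (B j `&` B k)))%:E)%E.
  rewrite (eq_integral (fun w =>
    (\sum_(j < m) \sum_(k < m) (\1_(B j `&` B k) w)%:E)%E)); last first.
    move=> w _; rewrite expr2 /X mulr_suml -sumEFin; apply: eq_bigr => j _.
    rewrite mulr_sumr -sumEFin; apply: eq_bigr => k _.
    by rewrite indicI.
  rewrite ge0_integral_sum //; last 2 first.
  - move=> j; apply: emeasurable_sum => k; apply/measurable_EFinP.
    by apply: measurable_indic; exact: measurableI.
  - by move=> j w _; apply: sume_ge0 => k _; rewrite lee_fin indicE.
  rewrite -sumEFin; apply: eq_bigr => j _.
  rewrite ge0_integral_sum //; last first.
    move=> k; apply/measurable_EFinP.
    by apply: measurable_indic; exact: measurableI.
  rewrite -sumEFin; apply: eq_bigr => k _.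
  have mBI : measurable (B j `&` B k) by exact: measurableI.
  by rewrite integral_indic // setIT EFin_probability.
pose c := 2 * (m%:R * b).
have c0 : 0 <= c by rewrite !mulr_ge0.
(* This integrates S^2 + 2mbX = X^2 + (mb)^2, the binomial formula with its negative term moved to
   the other side. *)
have key : (\int[P]_w (S w ^+ 2)%:E + (c * (m%:R * b))%:E =
   (\sum_(j < m) \sum_(k < m) fine (P (B j `&` B k)) + (m%:R * b) ^+ 2)%:E)%E.
  rewrite [in RHS]EFinD -EX2 [in LHS]EFinM -EX.
  have mXE : measurable_fun setT (fun w => (X w)%:E) by exact/measurable_EFinP.
  have mS2E : measurable_fun setT (fun w => (S w ^+ 2)%:E).
    exact/measurable_EFinP.
  have mX2E : measurable_fun setT (fun w => (X w ^+ 2)%:E).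
    exact/measurable_EFinP.
  have mcXE : measurable_fun setT (fun w => (c%:E * (X w)%:E)%E).
    by under eq_fun do rewrite -EFinM; apply/measurable_EFinP;
      exact: measurable_funM.
  have XE0 w : setT w -> (0 <= (X w)%:E)%E by rewrite lee_fin.
  have S2E0 w : setT w -> (0 <= (S w ^+ 2)%:E)%E by rewrite lee_fin sqr_ge0.
  have X2E0 w : setT w -> (0 <= (X w ^+ 2)%:E)%E by rewrite lee_fin sqr_ge0.
  have cXE0 w : setT w -> (0 <= c%:E * (X w)%:E)%E by rewrite lee_fin mulr_ge0.
  have b2E0 w : [set: T] w -> (0 <= ((m%:R * b) ^+ 2)%:E)%E.
    by rewrite lee_fin sqr_ge0.
  rewrite -ge0_integralZl_EFin //.
  rewrite -[((m%:R * b) ^+ 2)%:E]mule1 -(probability_setT P) -integral_cst //.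
  rewrite -!ge0_integralD //.
  apply: eq_integral => w _; rewrite -!EFinM -!EFinD; congr EFin.
  by rewrite /S /c; ring.
have markov_S : ((eps ^+ 2)%:E * P D <= \int[P]_w (S w ^+ 2)%:E)%E.
  have mDE : measurable_fun setT (fun w => (\1_D w : R)%:E).
    by apply/measurable_EFinP; exact: measurable_indic.
  have DE0 w : setT w -> (0 <= (\1_D w : R)%:E)%E by rewrite lee_fin.
  rewrite -[D]setIT -integral_indic // -ge0_integralZl_EFin //; last first.
    by rewrite sqr_ge0.
  apply: ge0_le_integral => //.
  - by move=> w _; rewrite -EFinM lee_fin mulr_ge0 ?sqr_ge0.
  - by under eq_fun do rewrite -EFinM; apply/measurable_EFinP;
      apply: measurable_funM => //; exact: measurable_indic.
  - exact/measurable_EFinP.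
  - move=> w _; rewrite -EFinM lee_fin indicE.
    have [/set_mem Dw|_] := boolP (w \in D); last by rewrite mulr0 sqr_ge0.
    rewrite mulr1 -[leRHS]real_normK ?num_real //.
    rewrite ler_sqr ?nnegrE ?normr_ge0 ?(ltW eps0) //.
    exact: ltW.
rewrite mulrC ler_pdivlMr ?exprn_gt0 // mulrC -lee_fin EFinM EFin_probability //.
apply: (le_trans markov_S); rewrite -(@leeD2rE _ (c * (m%:R * b))%:E) //.
rewrite key -EFinD lee_fin.
rewrite le_eqVlt; apply/orP; left; apply/eqP.
under [in RHS]eq_bigr do rewrite sumrB sumr_const card_ord.
rewrite sumrB sumr_const card_ord /c.
rewrite -[b ^+ 2 *+ m *+ m]mulr_natl -[b ^+ 2 *+ m]mulr_natl; ring.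
Qed.
End second_moment.

Section shift_lln.
Variables (R : realType) (mu : probability (path_space R) R).
Variable B : set (path_space R).
Hypothesis mB : measurable B.
Hypothesis inv : forall k (C : set (path_space R)), measurable C ->
  mu (@path_shift R k @^-1` C) = mu C.
Hypothesis mix :
  (fun k => fine (mu (@path_shift R k @^-1` B `&` B))) @ \oo -->
  fine (mu B) * fine (mu B).

Lemma measurable_preimage_shift k (C : set (path_space R)) :
  measurable C -> measurable (@path_shift R k @^-1` C).
Proof.
by move=> mC; rewrite -[X in measurable X]setTI; exact: measurable_path_shift.
Qed.

(** Chebyshev's inequality bounds the probability by 2 / eps^2 times the Cesaro mean of the absolute
    covariances at lags 0 to n. Mixing makes the covariances vanish, so their Cesaro means vanish
    too, without any rate. *)
Lemma shift_lln (eps : R) : 0 < eps ->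
  (fun n => fine (mu [set x | eps < `|n.+1%:R^-1 *
     \sum_(k < n.+1) \1_B (@path_shift R k x) - fine (mu B)|])) @ \oo --> 0.
Proof.
move=> eps0; set b := fine (mu B).
pose c k := fine (mu (@path_shift R k @^-1` B `&` B)) - b ^+ 2.
have c0 : (fun k => `|c k|) @ \oo --> 0.
  rewrite -[0](normr0 R); apply: cvg_norm.
  rewrite -[0](subrr (b ^+ 2)); apply: cvgB; last exact: cvg_cst.
  by rewrite expr2.
have := cesaro c0; rewrite /arithmetic_mean => cc.
have cc2 : (fun n => (2 * eps ^- 2) *
   (n.+1%:R^-1 * series (fun k => `|c k|) n.+1)) @ \oo --> 0.
  by rewrite -[0](mulr0 (2 * eps ^- 2)); apply: cvgM => //; exact: cvg_cst.
apply: (squeeze_cvgr _ (cvg_cst 0) cc2); apply: nearW => n.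
rewrite fine_probability_ge0 /=.
have -> : [set x | eps < `|n.+1%:R^-1 *
     \sum_(k < n.+1) \1_B (@path_shift R k x) - b|] =
  [set x | n.+1%:R * eps < `|\sum_(k < n.+1)
     (\1_(@path_shift R k @^-1` B) x : R) - n.+1%:R * b|].
  apply/seteqP; split => x /=; set S := \sum_(k < n.+1) _;
  (have -> : S - n.+1%:R * b = n.+1%:R * (n.+1%:R^-1 * S - b) by
    rewrite mulrBr mulrA divff ?pnatr_eq0 ?mul1r);
  by rewrite normrM normr_nat ltr_pM2l ?ltr0n.
have h := @count_deviation_le R _ _ mu (fun k => @path_shift R k @^-1` B) b
  (n.+1%:R * eps) n.+1.
apply: (le_trans (h _ _ _)).
- by move=> k; exact: measurable_preimage_shift.
- by move=> k; rewrite inv.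
- by rewrite mulr_gt0.
have h2 := @double_sum_dist_le R (fun j k => fine (mu (@path_shift R j @^-1` B
   `&` @path_shift R k @^-1` B)) - b ^+ 2) c n.+1.
apply: (le_trans (ler_wpM2l _ (h2 _ _))).
- by rewrite invr_ge0 sqr_ge0.
- by move=> j k; rewrite setIC.
- move=> j k jk; congr (fine _ - _).
  (* Invariance under the shift by [j] makes the covariance of the visits at times [j] and [k]
     depend on the lag [k - j] only. *)
  rewrite -(@inv j (@path_shift R (k - j) @^-1` B `&` B)); last first.
    by apply: measurableI => //; exact: measurable_preimage_shift.
  rewrite setIC; congr (mu _); apply/seteqP; split => x [];
  rewrite /path_shift /= => H1 H2; split => //; move: H1;
  by congr B; apply/funext => i; rewrite -addnA subnK.
rewrite seriesEord /= exprMn invfM le_eqVlt; apply/orP; left; apply/eqP.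
by field; rewrite (gt_eqF eps0) andbT addrC natr1 pnatr_eq0.
Qed.
End shift_lln.

Section almost_everywhere_equality.
Variables (R : realType) (d : measure_display) (T : measurableType d).
Variable P : probability T R.

Lemma ae_eq_probability (A B : set T) : measurable A -> measurable B ->
  {ae P, forall w, A w <-> B w} -> P A = P B.
Proof.
move=> mA mB AB.
have half (C D : set T) : measurable C -> measurable D ->
    {ae P, forall w, C w <-> D w} -> (P C <= P D)%E.
  move=> mC mD [N [mN PN NP]].
  have -> : P D = (P D + P N)%E by rewrite PN adde0.
  apply: le_trans (_ : P (D `|` N) <= _)%E; last exact: measureU2.
  apply: le_measure; rewrite ?inE //; first exact: measurableU.
  move=> w Cw; have [Nw|nNw] := pselect (N w); first by right.
  left; apply: contrapT => nDw; apply: nNw; apply: NP => /= -[CD _].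
  exact: nDw (CD Cw).
apply/eqP; rewrite eq_le !half //.
by apply: filterS AB => w [? ?]; split.
Qed.

End almost_everywhere_equality.

Lemma measurable_le_cst (R : realType) (d : measure_display) (T : measurableType d)
  (f : T -> R) (b : R) : measurable_fun setT f ->
  measurable [set w | f w <= b].
Proof.
move=> mf; rewrite (_ : [set w | _] = f @^-1` `]-oo, b]).
  by rewrite -[X in measurable X]setTI; exact: mf.
by apply/seteqP; split => w /=; rewrite in_itv.
Qed.

Lemma measurable_lt_dist (R : realType) (d : measure_display)
  (T : measurableType d) (f : T -> R) (c eta : R) : measurable_fun setT f ->
  measurable [set w | eta < `|f w - c|].
Proof.
move=> mf; rewrite (_ : [set w | _] =
   ~` [set w | (fun w => `|f w - c|) w <= eta]).
  apply: measurableC; apply: measurable_le_cst.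
  by apply: (measurableT_comp (@normr_measurable R setT));
    exact: measurable_funB.
by apply/seteqP; split => w /=; rewrite ltNge => /negP.
Qed.

Lemma measurable_le_fun (R : realType) (d : measure_display)
    (T : measurableType d) (f g : T -> R) :
  measurable_fun setT f -> measurable_fun setT g ->
  measurable [set w | f w <= g w].
Proof.
move=> mf mg; rewrite (_ : [set w | _] = [set w | (f \- g) w <= 0]).
  by apply: measurable_le_cst; exact: measurable_funB.
by apply/seteqP; split => w /=; rewrite subr_le0.
Qed.

Lemma measurable_le_indicator (R : realType) (d : measure_display)
    (T : measurableType d) (f g : T -> R) :
  measurable_fun setT f -> measurable_fun setT g ->
  measurable_fun setT (fun w => (f w <= g w)%R%:R : R).
Proof.
move=> mf mg; rewrite (_ : (fun w => _) = \1_[set w | f w <= g w]%R).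
  by apply: measurable_indic; exact: measurable_le_fun.
by apply/funext => w; rewrite indicE; congr (nat_of_bool _)%:R;
  apply/idP/idP => [|/set_mem]; rewrite ?inE.
Qed.

(** * From the innovations to the path space *)

Section past_path.
Variables (R : realType) (dd : measure_display) (T : measurableType dd).
Variables (P : probability T R) (eps : int -> T -> R).
Hypothesis meps : forall s, measurable_fun setT (eps s).

(** The path is read backwards in time, so that going [k] steps into the past deletes its first [k]
    coordinates and a one-sided shift suffices. *)
Definition past_path (s : int) (w : T) : path_space R :=
  fun i => eps (s - i%:Z) w.

Lemma measurable_past_path s : measurable_fun setT (past_path s).
Proof. by apply: measurable_to_path => i; exact: meps. Qed.

Lemma past_path_shift s k w :
  past_path (s - k%:Z) w = path_shift k (past_path s w).
Proof.
apply/funext => i; rewrite /past_path /path_shift.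
by congr (eps _ w); lia.
Qed.

Lemma measurable_past_preimage s (B : set (path_space R)) :
  measurable B -> measurable (past_path s @^-1` B).
Proof.
by move=> mB; rewrite -[X in measurable X]setTI; exact: measurable_past_path.
Qed.

Definition past_law (s : int) : probability (path_space R) R :=
  distribution P (mfun_Sub (mem_set (measurable_past_path s))).

Lemma past_lawE s (B : set (path_space R)) :
  past_law s B = P (past_path s @^-1` B).
Proof. by []. Qed.

Hypothesis ind : mutually_independent P eps.
Hypothesis idd : identically_distributed P eps 0.

Lemma past_law_cylinder s (A : nat -> set R) (n : nat) :
  (forall i, measurable (A i)) -> (forall i, (n <= i)%N -> A i = setT) ->
  past_law s [set x | forall i, A i (x i)] =
  (\prod_(0 <= i < n) P (eps 0 @^-1` A i))%E.
Proof.
(* Independence is stated for sets indexed by all integer times, so [A] is extended to them; only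
   the times s - i with i < n, where |s - u| = i, enter the intersection. *)
move=> mA An; pose A' (u : int) := A `|s - u|%N.
pose J : seq int := [seq s - (i : nat)%:Z | i <- iota 0 n].
have uJ : uniq J.
  rewrite map_inj_uniq ?iota_uniq // => i j /addrI /oppr_inj [].
  by [].
have A'E i : A' (s - i%:Z) = A i.
  by rewrite /A' opprB addrC subrK absz_nat.
rewrite past_lawE.
have -> : past_path s @^-1` [set x | forall i, A i (x i)] =
    \bigcap_(u in [set u | u \in J]) (eps u @^-1` A' u).
  apply/seteqP; split => w /=.
    move=> Aw u /= /mapP[i _ ->]; rewrite A'E; exact: Aw.
  move=> H i; case: (ltnP i n) => ni; last by rewrite An.
  rewrite -A'E; apply: H => /=; apply/mapP; exists i => //.
  by rewrite mem_iota.
rewrite ind //; last by move=> u; exact: mA.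
rewrite /J big_map /index_iota subn0; apply: eq_bigr => i _.
by rewrite A'E idd.
Qed.

Lemma past_law_stationary s s' (B : set (path_space R)) : measurable B ->
  past_law s B = past_law s' B.
Proof.
move=> mB.
apply: (@measure_unique _ _ (path_space R) (@cylinder R) (fun=> setT) erefl
  _ _ _ (past_law s) (past_law s')) => //.
- exact: cylinder_setI.
- by move=> _; exact: cylinder_setT.
- by rewrite bigcup_const.
- move=> _ [A [mA [n An] ->]].
  exact: (etrans (@past_law_cylinder s A n mA An)
    (esym (@past_law_cylinder s' A n mA An))).
- by move=> _; rewrite ltey_eq fin_num_measure.
Qed.

Variables (t : int) (g : path_space R -> R) (X : nat -> T -> R).
Hypothesis mg : measurable_fun setT g.
Hypothesis mX : forall k, measurable_fun setT (X k).
Hypothesis Xg : forall k, {ae P, forall w, X k w = g (past_path (t - k%:Z) w)}.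

(** Almost surely, {[X k] <= b} says that the k-fold shift of one path lies in the set {g <= b}. The
    weak law on path space then carries over to [T]. *)
Lemma empirical_cdf_cvg (b eta : R) : 0 < eta ->
  (fun n => fine (P [set w | eta < `|n.+1%:R^-1 *
     \sum_(k < n.+1) (X k w <= b)%R%:R - fine (P [set w | X 0%N w <= b])|]))
  @ \oo --> 0.
Proof.
move=> eta0; pose B := [set x : path_space R | g x <= b].
have mB : measurable B by exact: measurable_le_cst.
have PB : P [set w | X 0%N w <= b] = past_law t B.
  rewrite past_lawE; apply: ae_eq_probability.
  - exact: measurable_le_cst.
  - exact: measurable_past_preimage.
  - by apply: filterS (Xg 0%N) => w; rewrite subr0 /B /= => ->.
have prodl := past_law_cylinder t.
pose nu A := P (eps 0 @^-1` A).
have := @shift_lln R (past_law t) B mB (@shift_invariant R _ nu prodl)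
  (@shift_mixing R _ nu prodl B B mB mB) eta eta0.
rewrite -PB; apply: cvg_trans; apply: near_eq_cvg; apply: nearW => n.
rewrite past_lawE /=; congr fine; apply: ae_eq_probability.
- apply: measurable_past_preimage.
  apply: measurable_lt_dist; apply: measurable_funM => //.
  apply: measurable_sum => k.
  apply: measurableT_comp; last exact: measurable_path_shift.
  exact: measurable_indic.
- apply: measurable_lt_dist; apply: measurable_funM => //.
  apply: measurable_sum => k.
  exact: measurable_le_indicator.
(* The exceptional null sets for the countably many [k] are merged into one. *)
- have := ae_foralln Xg; apply: filterS => w Xw /=.
  suff -> : \sum_(k < n.+1) \1_B (path_shift k (past_path t w)) =
     \sum_(k < n.+1) (X k w <= b)%R%:R :> R by [].
  apply: eq_bigr => k _; rewrite -past_path_shift indicE Xw.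
  by congr (nat_of_bool _)%:R; apply/idP/idP => [/set_mem|]; rewrite ?inE.
Qed.

End past_path.

Arguments past_path {R dd T} eps s w.

(** * Dependence of the forecast coefficients on the autoregressive parameter *)

Section forecast_coefficients.
Variables (R : realType) (d : nat).

Lemma phi_hS (psi : 'cV[R]_d) h i :
  phi_h psi h.+1 i 0 = \sum_j companion psi i j * phi_h psi h j 0.
Proof. by rewrite /phi_h exprS -mulmxE -mulmxA mxE. Qed.

Lemma phi_h0 (psi : 'cV[R]_d) i : phi_h psi 0 i 0 = e1 R d i 0.
Proof. by rewrite /phi_h expr0 mul1mx. Qed.

(** By the recursion [phi_hS], each entry is built from entries of the parameter and constants by
    finitely many sums and products, so the limit passes through by induction on [h]. *)
Lemma cvg_phi_h (S : Type) (F : set_system S) (FF : Filter F)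
    (psi : S -> 'cV[R]_d) (phi : 'cV[R]_d) h i :
  (forall i, (fun s => psi s i 0) @ F --> phi i 0) ->
  (fun s => phi_h (psi s) h i 0) @ F --> phi_h phi h i 0.
Proof.
move=> cpsi; elim: h i => [|h IHh] i.
  under eq_cvg do rewrite phi_h0.
  by rewrite phi_h0; apply: cvg_cst.
under eq_cvg do rewrite phi_hS.
rewrite phi_hS; apply: cvg_big => [|j _]; first exact: add_continuous.
apply: cvgM => //; rewrite /companion.
under eq_cvg do rewrite mxE.
rewrite mxE; case: ifP => _; last exact: cvg_cst.
exact: cpsi.
Qed.

Lemma phi_h_near (phi : 'cV[R]_d) h (e : R) : 0 < e ->
  exists2 delta : R, 0 < delta & forall psi : 'cV[R]_d,
    (forall i, `|psi i 0 - phi i 0| <= delta) ->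
    forall i, `|phi_h psi h i 0 - phi_h phi h i 0| <= e.
Proof.
move=> e0; have FF : Filter (nbhs phi) by typeclasses eauto.
have : \forall psi \near phi, forall i,
    `|phi_h psi h i 0 - phi_h phi h i 0| <= e.
  apply: (@filter_forall _ _ _ (nbhs phi) FF) => i.
  have cphi j : (fun psi : 'cV[R]_d => psi j 0) @ nbhs phi --> phi j 0.
    exact: (@coord_continuous R d 1 j 0 phi).
  have /cvgrPdist_le /(_ _ e0) := @cvg_phi_h _ _ FF id phi h i cphi.
  apply: (@filterS _ _ FF) => psi; by rewrite distrC.
(* Balls are defined by a strict inequality while the assumption on [psi] is non-strict, hence half
   the radius. *)
move=> /nbhs_ballP [r /= r0 Hr]; exists (r / 2); first by rewrite divr_gt0.
move=> psi Hpsi; apply: Hr; split=> // i j.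
rewrite (ord1 j) /ball /= distrC (le_lt_trans (Hpsi i)) //.
by rewrite ltr_pdivrMr // ltr_pMr // ltr1n.
Qed.

Lemma measurable_phi_h (dd : measure_display) (T : measurableType dd)
    (psi : T -> 'cV[R]_d) h i :
  (forall i, measurable_fun setT (fun w => psi w i 0)) ->
  measurable_fun setT (fun w => phi_h (psi w) h i 0).
Proof.
move=> mpsi; elim: h i => [|h IHh] i.
  by under eq_fun do rewrite phi_h0; exact: measurable_cst.
under eq_fun do rewrite phi_hS.
apply: measurable_sum => j; apply: measurable_funM => //.
rewrite /companion; under eq_fun do rewrite mxE.
by case: (j == 0 :> nat); [exact: mpsi|exact: measurable_cst].
Qed.

End forecast_coefficients.

(** * The series solution as a measurable function of the path *)

Section moving_average.
Variables (R : realType) (d : nat) (phi : 'cV[R]_d).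

(* An upper limit rather than a limit, so that measurability is unconditional. *)
Definition ma_limit (x : path_space R) : R :=
  fine (limn_esup (fun N => (\sum_(i < N) ma_coef phi i * x i)%:E)).

Lemma measurable_ma_limit : measurable_fun setT ma_limit.
Proof.
apply: measurableT_comp => //; apply: measurable_fun_limn_esup => N.
apply/measurable_EFinP; apply: measurable_sum => i.
by apply: measurable_funM => //; exact: measurable_coord.
Qed.

Lemma ma_limitE (x : path_space R) (y : R) :
  (fun N => \sum_(i < N) ma_coef phi i * x i) @ \oo --> y -> ma_limit x = y.
Proof.
move=> xy; rewrite /ma_limit.
have xyE : (fun N => (\sum_(i < N) ma_coef phi i * x i)%:E) @ \oo --> y%:E.
  by apply: cvg_EFin => //; exact: nearW.
rewrite is_cvg_limn_esupE; last by apply/cvg_ex; exists y%:E.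
by rewrite (cvg_lim _ xyE).
Qed.

End moving_average.

(** * Distribution functions and quantiles *)

Section quantiles.
Variables (R : realType) (d : measure_display) (T : measurableType d).
Variables (P : probability T R) (X : T -> R).
Hypothesis mX : measurable_fun setT X.
Let F := marg_cdf P X.

Lemma measurable_lt_cst b : measurable [set w | X w < b].
Proof.
rewrite (_ : [set w | _] = X @^-1` `]-oo, b[).
  by rewrite -[X in measurable X]setTI; exact: mX.
by apply/seteqP; split => w /=; rewrite in_itv.
Qed.

Lemma marg_cdf_le x y : x <= y -> F x <= F y.
Proof.
move=> xy; apply: le_fine_probability; try exact: measurable_le_cst.
by move=> w /= Xw; exact: le_trans xy.
Qed.

Lemma prob_lt_atomless b : (forall x, P (X @^-1` [set x]) = 0%E) ->
  fine (P [set w | X w < b]) = F b.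
Proof.
move=> noatom; apply/eqP; rewrite eq_le; apply/andP; split.
  apply: le_fine_probability; [exact: measurable_lt_cst|exact: measurable_le_cst|].
  by move=> w /= /ltW.
have mb : measurable (X @^-1` [set b]).
  by rewrite -[X in measurable X]setTI; apply: mX.
have := @fine_probabilityU_le _ _ _ P _ _ (measurable_lt_cst b) mb.
rewrite noatom addr0; apply: le_trans.
apply: le_fine_probability.
- exact: measurable_le_cst.
- by apply: measurableU => //; exact: measurable_lt_cst.
- by move=> w /=; rewrite le_eqVlt => /orP[/eqP|]; [right|left].
Qed.

Lemma marg_cdf_cvg1 : (fun n : nat => F n%:R) @ \oo --> (1 : R).
Proof.
have E : fine (P (\bigcup_n [set w | X w <= n%:R])) = 1.
  rewrite (_ : \bigcup_n _ = setT) ?probability_setT //.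
  apply/seteqP; split => // w _; exists (Num.truncn (X w)).+1 => //=.
  exact/ltW/truncnS_gt.
suff : (fun n : nat => F (n%:R)) @ \oo -->
    fine (P (\bigcup_n [set w | X w <= n%:R])) by rewrite E.
apply: (fine_cvg (f := fun n : nat => P [set w | X w <= n%:R])).
rewrite EFin_probability; last first.
  by apply: bigcupT_measurable => n; exact: measurable_le_cst.
apply: (@nondecreasing_cvg_mu _ _ _ P (fun n : nat => [set w | X w <= n%:R])).
  by move=> n; exact: measurable_le_cst.
  by apply: bigcupT_measurable => n; exact: measurable_le_cst.
move=> n m nm; apply/subsetPset => w /= /le_trans; apply.
by rewrite ler_nat.
Qed.

Lemma marg_cdf_cvg0 : (fun n : nat => F (- n%:R)) @ \oo --> (0 : R).
Proof.
have E : fine (P (\bigcap_n [set w | X w <= - n%:R])) = 0.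
  rewrite (_ : \bigcap_n _ = set0) ?measure0 //.
  rewrite -subset0 => w /(_ (Num.truncn (- X w)).+1 I) /=.
  by rewrite leNgt => /negP; apply; rewrite ltrNl; exact: truncnS_gt.
suff : (fun n : nat => F (- n%:R)) @ \oo -->
    fine (P (\bigcap_n [set w | X w <= - n%:R])) by rewrite E.
apply: (fine_cvg (f := fun n : nat => P [set w | X w <= - n%:R])).
rewrite EFin_probability; last first.
  by apply: bigcapT_measurable => n; exact: measurable_le_cst.
apply: (@nonincreasing_cvg_mu _ _ _ P (fun n : nat => [set w | X w <= - n%:R])).
- by rewrite ltey_eq fin_num_measure //; exact: measurable_le_cst.
- by move=> n; exact: measurable_le_cst.
- by apply: bigcapT_measurable => n; exact: measurable_le_cst.
move=> n m nm; apply/subsetPset => w /= /le_trans; apply.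
by rewrite lerN2 ler_nat.
Qed.

Section level.
Variable u : R.
Hypothesis u01 : 0 < u < 1.
Let q := gen_inverse F u.

Lemma marg_cdf_lt_gen_inverse y : y < q -> F y < u.
Proof.
move=> yq; rewrite ltNge; apply/negP => uy.
suff : q <= y by rewrite leNgt yq.
apply: ge_inf => //.
(* [inf] has its meaning only on sets bounded below; since F tends to 0 at minus infinity and u > 0,
   the superlevel set is. *)
have /andP[u0 _] := u01.
have /cvgrPdist_lt /(_ _ u0) [n _ /(_ n (leqnn n))] := marg_cdf_cvg0.
rewrite sub0r normrN => Fn; exists (- n%:R) => z /= uz.
rewrite leNgt; apply/negP => zn.
have := le_lt_trans (le_trans uz (@marg_cdf_le _ _ (ltW zn)))
  (le_lt_trans (ler_norm _) Fn).
by rewrite ltxx.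
Qed.

Lemma marg_cdf_gt_gen_inverse y : q < y -> u <= F y.
Proof.
move=> qy; have /andP[_ u1] := u01.
have Sn : [set z | u <= F z] !=set0.
  have u10 : 0 < 1 - u by rewrite subr_gt0.
  have /cvgrPdist_lt /(_ _ u10) [n _ /(_ n (leqnn n))] := marg_cdf_cvg1.
  by move=> /(le_lt_trans (ler_norm _)) Fn; exists n%:R => /=; lra.
rewrite leNgt; apply/negP => Fy.
suff : y <= q by rewrite leNgt qy.
apply: lb_le_inf => // z /= uz; rewrite leNgt; apply/negP => zy.
have := le_lt_trans (le_trans uz (@marg_cdf_le _ _ (ltW zy))) Fy.
by rewrite ltxx.
Qed.

(** The event is the increasing union of {X <= q - 1/(n+1)}, each of probability below [u]; this is
    continuity from below. *)
Lemma prob_lt_gen_inverse : fine (P [set w | X w < q]) <= u.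
Proof.
have -> : [set w | X w < q] = \bigcup_n [set w | X w <= q - n.+1%:R^-1].
  apply/seteqP; split => w /=.
    move=> Xq; have d0 : 0 < q - X w by rewrite subr_gt0.
    have [n] := ltr_add_invr (y := X w) (x := q) Xq => H.
    by exists n => //=; rewrite lerBrDr ltW.
  move=> [n _ /= Xw]; apply: le_lt_trans Xw _.
  by rewrite ltrBlDr ltrDl invr_gt0.
have mA n : measurable [set w | X w <= q - n.+1%:R^-1].
  exact: measurable_le_cst.
have mU : measurable (\bigcup_n [set w | X w <= q - n.+1%:R^-1]).
  exact: bigcupT_measurable.
have h : (fun n => F (q - n.+1%:R^-1)) @ \oo -->
    fine (P (\bigcup_n [set w | X w <= q - n.+1%:R^-1])).
  apply: (fine_cvg (f := fun n : nat => P [set w | X w <= q - n.+1%:R^-1])).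
  rewrite EFin_probability //.
  apply: (@nondecreasing_cvg_mu _ _ _ P
    (fun n : nat => [set w | X w <= q - n.+1%:R^-1])) => // n m nm.
  apply/subsetPset => w /= /le_trans.
  by apply; rewrite lerB // lef_pV2 ?posrE // ler_nat ltnS.
rewrite -(cvg_lim (@Rhausdorff R) h).
apply: limr_le; first by apply/cvg_ex; eexists; exact: h.
apply: nearW => n; apply/ltW/marg_cdf_lt_gen_inverse.
by rewrite ltrBlDr ltrDl invr_gt0.
Qed.

(** Right-continuity of F at [q], through the decreasing intersection of {X <= q + 1/(n+1)}. *)
Lemma prob_le_gen_inverse : u <= F q.
Proof.
have qE : [set w | X w <= q] = \bigcap_n [set w | X w <= q + n.+1%:R^-1].
  apply/seteqP; split => w /=.
    by move=> Xq n _ /=; apply: (le_trans Xq); rewrite lerDl invr_ge0.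
  move=> H; rewrite leNgt; apply/negP => qX.
  have [n] := ltr_add_invr (y := q) (x := X w) qX => Hn.
  by have := H n I; rewrite /= leNgt Hn.
have mA n : measurable [set w | X w <= q + n.+1%:R^-1].
  exact: measurable_le_cst.
have mI : measurable (\bigcap_n [set w | X w <= q + n.+1%:R^-1]).
  exact: bigcapT_measurable.
have h : (fun n => F (q + n.+1%:R^-1)) @ \oo -->
    fine (P (\bigcap_n [set w | X w <= q + n.+1%:R^-1])).
  apply: (fine_cvg (f := fun n : nat => P [set w | X w <= q + n.+1%:R^-1])).
  rewrite EFin_probability //.
  apply: (@nonincreasing_cvg_mu _ _ _ P
    (fun n : nat => [set w | X w <= q + n.+1%:R^-1])) => //.
    by rewrite ltey_eq fin_num_measure.
  move=> n m nm; apply/subsetPset => w /= /le_trans.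
  by apply; rewrite lerD // lef_pV2 ?posrE // ler_nat ltnS.
rewrite /F /marg_cdf qE; rewrite -(cvg_lim (@Rhausdorff R) h).
apply: limr_ge; first by apply/cvg_ex; eexists; exact: h.
apply: nearW => n.
by apply: marg_cdf_gt_gen_inverse; rewrite ltrDl invr_gt0.
Qed.

(** P(X < q) <= u <= F(q) holds in general, and continuity closes the gap: P(X < q) dominates F(q -
    1/(n+1)), which tends to F(q). This version serves the marginal of Y, the atomless one below
    serves the projection. *)
Lemma marg_cdf_gen_inverse_continuous : {for q, continuous F} ->
  fine (P [set w | X w < q]) = u.
Proof.
move=> cF; apply/eqP; rewrite eq_le prob_lt_gen_inverse /=.
apply: le_trans prob_le_gen_inverse _.
have h : (fun n => F (q - n.+1%:R^-1)) @ \oo --> F q.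
  have : (fun n : nat => q - n.+1%:R^-1) @ \oo --> q - 0.
    by apply: cvgB; [exact: cvg_cst|exact: cvg_harmonic].
  rewrite subr0 => cq; exact: (cvg_comp _ _ cq cF).
rewrite -(cvg_lim (@Rhausdorff R) h).
apply: limr_le; first by apply/cvg_ex; eexists; exact: h.
apply: nearW => n; apply: le_fine_probability.
- exact: measurable_le_cst.
- exact: measurable_lt_cst.
- move=> w /= Xw; apply: le_lt_trans Xw _.
  by rewrite ltrBlDr ltrDl invr_gt0.
Qed.

Lemma marg_cdf_gen_inverse_atomless : (forall x, P (X @^-1` [set x]) = 0%E) ->
  F q = u.
Proof.
move=> noatom; apply/eqP; rewrite eq_le prob_le_gen_inverse andbT.
by rewrite -prob_lt_atomless // prob_lt_gen_inverse.
Qed.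

End level.
End quantiles.

Lemma density_atomless (R : realType) (dd : measure_display)
    (T : measurableType dd) (P : probability T R) (X : T -> R) :
  has_lebesgue_density P X -> forall x, P (X @^-1` [set x]) = 0%E.
Proof.
by move=> [f [mf [f0 fP]]] x; rewrite fP // integral_set1.
Qed.

(** * Deterministic comparison of perturbed ranks with counts at a fixed threshold *)

Lemma le_of_perturbed_le (R : realFieldType) (x y x' y' c rho b : R) :
  `|x' - x| <= c -> `|y' - y| <= c -> 2 * c <= rho -> y + rho <= b ->
  x' <= y' -> x <= b.
Proof. by rewrite !ler_norml => /andP[? ?] /andP[? ?]; lra. Qed.

Lemma perturbed_le_of_le (R : realFieldType) (x y x' y' c rho b : R) :
  `|x' - x| <= c -> `|y' - y| <= c -> 2 * c <= rho -> b <= y - rho ->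
  x <= b -> x' <= y'.
Proof. by rewrite !ler_norml => /andP[? ?] /andP[? ?]; lra. Qed.

Section rank_comparison.
Variables (R : realFieldType) (v vh N : nat -> R) (M rho eta : R).
Hypotheses (eta0 : 0 <= eta) (etaM : 2 * (eta * M) <= rho).
Hypothesis vhv : forall k, `|vh k - v k| <= eta * N k.
Hypothesis N0M : N 0%N <= M.

Let close k : N k <= M -> `|vh k - v k| <= eta * M.
Proof. by move=> NkM; apply: (le_trans (vhv k)); rewrite ler_wpM2l. Qed.

(** The comparison is termwise. If [N k <= M], the errors at [k] and at 0 are each at most eta * M,
    and the margin [rho] absorbs both. Any other [k] contributes at most 1, paid for by the last
    bracket. *)
Lemma rank_le_count (b : R) (m : nat) : v 0%N + rho <= b ->
  \sum_(k < m) (vh k <= vh 0%N)%R%:R <=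
  \sum_(k < m) (v k <= b)%R%:R + (m%:R - \sum_(k < m) (N k <= M)%R%:R) :> R.
Proof.
move=> vb; rewrite -[m in m%:R]card_ord -sumr_const -sumrB -big_split /=.
apply: ler_sum => k _; case: (leP (N k) M) => [NkM|_]; last first.
  rewrite subr0; apply: (@le_trans _ _ 1); last by rewrite lerDr ler0n.
  by rewrite lern1 leq_b1.
rewrite subrr addr0; have [vhk|] := boolP (vh k <= vh 0%N); last by [].
suff -> : v k <= b by [].
exact: (@le_of_perturbed_le _ _ _ _ _ _ _ _
  (@close _ NkM) (@close _ N0M) etaM vb).
Qed.

Lemma count_le_rank (b : R) (m : nat) : b <= v 0%N - rho ->
  \sum_(k < m) (v k <= b)%R%:R <=
  \sum_(k < m) (vh k <= vh 0%N)%R%:R + (m%:R - \sum_(k < m) (N k <= M)%R%:R)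
  :> R.
Proof.
move=> vb; rewrite -[m in m%:R]card_ord -sumr_const -sumrB -big_split /=.
apply: ler_sum => k _; case: (leP (N k) M) => [NkM|_]; last first.
  rewrite subr0; apply: (@le_trans _ _ 1); last by rewrite lerDr ler0n.
  by rewrite lern1 leq_b1.
rewrite subrr addr0; have [vk|] := boolP (v k <= b); last by [].
suff -> : vh k <= vh 0%N by [].
exact: (@perturbed_le_of_le _ _ _ _ _ _ _ _
  (@close _ NkM) (@close _ N0M) etaM vb).
Qed.

End rank_comparison.

Lemma near_subn (Q : nat -> Prop) (d : nat) :
  (\forall n \near \oo, Q n) -> \forall n \near \oo, Q (n - d)%N.
Proof.
move=> [K _ QK]; exists (K + d)%N => // n /= Kdn; apply: QK => /=.
by rewrite leq_subRL ?(leq_trans _ Kdn) ?leq_addl // addnC.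
Qed.

(** The bound is uniform in [A], so one comparison of events serves both the probability and the
    numerator of the conditional probability. *)
Lemma probability_dist_le (R : realType) (d : measure_display)
    (T : measurableType d) (P : probability T R) (A B C D : set T) :
  measurable A -> measurable B -> measurable C -> measurable D ->
  (forall w, ~ B w -> (C w <-> D w)) ->
  `|fine (P (A `&` C)) - fine (P (A `&` D))| <= fine (P B).
Proof.
move=> mA mB mC mD CD.
have half (C' D' : set T) : measurable C' -> measurable D' ->
    (forall w, ~ B w -> C' w -> D' w) ->
    fine (P (A `&` C')) <= fine (P (A `&` D')) + fine (P B).
  move=> mC' mD' CD'.
  have mAD : measurable (A `&` D') by exact: measurableI.
  apply: le_trans (@fine_probabilityU_le _ _ _ P _ _ mAD mB).
  apply: le_fine_probability; [exact: measurableI|exact: measurableU|].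
  move=> w [Aw Cw]; have [Bw|nBw] := pselect (B w); first by right.
  by left; split=> //; exact: CD' Cw.
have h1 := half C D mC mD (fun w nB => (CD w nB).1).
have h2 := half D C mD mC (fun w nB => (CD w nB).2).
by rewrite ler_norml; apply/andP; split; lra.
Qed.

Lemma fine_probability_bigsetU_le (R : realType) (d : measure_display)
    (T : measurableType d) (P : probability T R) (I : Type) (r : seq I)
    (A : I -> set T) : (forall i, measurable (A i)) ->
  fine (P (\big[setU/set0]_(i <- r) A i)) <= \sum_(i <- r) fine (P (A i)).
Proof.
move=> mA; elim: r => [|i r IHr]; first by rewrite !big_nil measure0.
rewrite !big_cons.
have mU : measurable (\big[setU/set0]_(j <- r) A j).
  exact: bigsetU_measurable.
apply: le_trans (@fine_probabilityU_le _ _ _ P _ _ (mA i) mU) _.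
by rewrite lerD2l.
Qed.


(** * Agreement of the empirical and the limiting event at level p *)

Section rank_consistency.
Variables (R : realType) (dd : measure_display) (T : measurableType dd).
Variables (P : probability T R) (V N : nat -> T -> R).
Variables (Vh : nat -> nat -> T -> R) (d : nat) (p : R).
Hypotheses (mV : forall k, measurable_fun setT (V k))
  (mN : forall k, measurable_fun setT (N k)).
Let F := marg_cdf P (V 0%N).
Hypothesis noatom : forall x, P (V 0%N @^-1` [set x]) = 0%E.
Hypothesis p01 : 0 < p < 1.

Let freq (X : nat -> T -> R) (b : R) (n : nat) (w : T) : R :=
  n.+1%:R^-1 * \sum_(k < n.+1) (X k w <= b)%R%:R.

Hypothesis llnV : forall b eta : R, 0 < eta ->
  (fun n => fine (P [set w | eta < `|freq V b n w - F b|])) @ \oo --> (0 : R).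
Hypothesis llnN : forall b eta : R, 0 < eta ->
  (fun n => fine (P [set w | eta < `|freq N b n w -
    marg_cdf P (N 0%N) b|])) @ \oo --> (0 : R).
(** A single exceptional event per n serves all [k], because the coefficient error does not involve
    [k]; the dependence on [k] sits in the factor [N k]. *)
Hypothesis consistent : forall eta : R, 0 < eta ->
  exists E : nat -> set T, [/\ forall n, measurable (E n),
    (fun n => fine (P (E n))) @ \oo --> (0 : R) &
    forall n w, ~ E n w -> forall k, `|Vh n k w - V k w| <= eta * N k w].

Let measurable_freq_dev (X : nat -> T -> R) b eta c n :
  (forall k, measurable_fun setT (X k)) ->
  measurable [set w | eta < `|freq X b n w - c|].
Proof.
move=> mX; apply: measurable_lt_dist; apply: measurable_funM => //.
apply: measurable_sum => k.
exact: measurable_le_indicator.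
Qed.

(* With a < b < b' < c the quantiles of levels p - s, p - s/2, p + s/2, p + s,
   off [a <= V 0 <= c] a perturbation of the projections smaller than the gaps
   b - a and c - b' cannot carry the empirical rank across the level p. *)
Lemma rank_threshold_consistency (e : R) : 0 < e ->
  \forall n \near \oo, exists2 B : set T,
    measurable B /\ fine (P B) <= e & forall w, ~ B w ->
    ((p <= (n - d).+1%:R^-1 *
       \sum_(k < (n - d).+1) (Vh n k w <= Vh n 0%N w)%R%:R) <->
     (p <= F (V 0%N w))).
Proof.
move=> e0; have /andP[p0 p1] := p01.
(* The last two bounds keep p - s and p + s inside (0, 1). With the first, the exceptional events
   below cost at most 2s + s/8 + 4(e/8), which is less than e. *)
pose s := Num.min (e / 8) (Num.min (p / 2) ((1 - p) / 2)).
have s0 : 0 < s by rewrite !lt_min !divr_gt0 ?subr_gt0.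
have [se sp s1p] : [/\ s <= e / 8, s <= p / 2 & s <= (1 - p) / 2].
  by split; rewrite !ge_min lexx ?orbT.
have quant u : 0 < u < 1 -> F (gen_inverse F u) = u.
  by move=> u01; exact: marg_cdf_gen_inverse_atomless.
have F_lt x y : F x < F y -> x < y.
  rewrite !ltNge; apply: contra; exact: marg_cdf_le.
pose a := gen_inverse F (p - s); pose b := gen_inverse F (p - s / 2).
pose b' := gen_inverse F (p + s / 2); pose c := gen_inverse F (p + s).
have Fa : F a = p - s by apply: quant; apply/andP; split; lra.
have Fb : F b = p - s / 2 by apply: quant; apply/andP; split; lra.
have Fb' : F b' = p + s / 2 by apply: quant; apply/andP; split; lra.
have Fc : F c = p + s by apply: quant; apply/andP; split; lra.
have ab : a < b by apply: F_lt; rewrite Fa Fb; lra.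
have b'c : b' < c by apply: F_lt; rewrite Fc Fb'; lra.
pose rho := Num.min (b - a) (c - b').
have rho0 : 0 < rho by rewrite lt_min !subr_gt0 ab.
have [rhoab rhobc] : rho <= b - a /\ rho <= c - b'.
  by split; rewrite ge_min lexx ?orbT.
have s80 : 0 < s / 8 by rewrite divr_gt0.
have [M M0 NM] : exists2 M : R, 0 < M &
    1 - s / 8 < marg_cdf P (N 0%N) M.
  have /cvgrPdist_lt /(_ _ s80) [m _ Hm] := marg_cdf_cvg1 P (mN 0%N).
  exists m.+1%:R => //; have := Hm m.+1 (leqnSn m).
  by move=> /(le_lt_trans (ler_norm _)); lra.
(* The largest coefficient error for which the two errors eta * M still fit into the gap [rho]. *)
pose eta := rho / (2 * M).
have eta0 : 0 < eta by rewrite divr_gt0 // mulr_gt0.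
have etaM : 2 * (eta * M) <= rho.
  by rewrite /eta le_eqVlt; apply/orP; left; apply/eqP; field; rewrite gt_eqF.
have [E [mE PE HE]] := @consistent _ eta0.
have e80 : 0 < e / 8 by rewrite divr_gt0.
have small (u : nat -> R) : u @ \oo --> (0 : R) ->
    \forall n \near \oo, u n <= e / 8.
  move=> /cvgrPdist_le /(_ _ e80); apply: filterS => n.
  by rewrite sub0r normrN; exact: le_trans (ler_norm _).
have smallE := small _ PE.
have smallb := near_subn d (small _ (@llnV b _ s80)).
have smallb' := near_subn d (small _ (@llnV b' _ s80)).
have smallM := near_subn d (small _ (@llnN M _ s80)).
near=> n; set m := (n - d)%N.
pose B1 := [set w | V 0%N w <= c] `\` [set w | V 0%N w < a].
pose B2 := [set w | s / 8 < `|freq V b m w - F b|].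
pose B3 := [set w | s / 8 < `|freq V b' m w - F b'|].
pose B4 := [set w | s / 8 < `|freq N M m w - marg_cdf P (N 0%N) M|].
pose B5 := ~` [set w | N 0%N w <= M].
have mlt x : measurable [set w | V 0%N w < x] by exact: measurable_lt_cst.
have mle x : measurable [set w | V 0%N w <= x] by exact: measurable_le_cst.
have mB1 : measurable B1 by exact: measurableD.
have mB2 : measurable B2 by exact: measurable_freq_dev.
have mB3 : measurable B3 by exact: measurable_freq_dev.
have mB4 : measurable B4 by exact: measurable_freq_dev.
have mNM : measurable [set w | N 0%N w <= M] by exact: measurable_le_cst.
have mB5 : measurable B5 by exact: measurableC.
have PB1 : fine (P B1) <= 2 * s.
  rewrite fine_probabilityD //; last first.
    move=> w /= Va; apply/ltW/(lt_trans Va)/F_lt; rewrite Fa Fc; lra.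
  have FcE : fine (P [set w | V 0%N w <= c]) = p + s := Fc.
  by rewrite FcE prob_lt_atomless // -/F Fa; lra.
have PB5 : fine (P B5) <= s / 8.
  rewrite /B5 -setTD fine_probabilityD // probability_setT /=.
  by have := NM; rewrite /marg_cdf; lra.
have PB2 : fine (P B2) <= e / 8 by rewrite /B2 /m; near: n.
have PB3 : fine (P B3) <= e / 8 by rewrite /B3 /m; near: n.
have PB4 : fine (P B4) <= e / 8 by rewrite /B4 /m; near: n.
have PEn : fine (P (E n)) <= e / 8 by near: n.
exists (B1 `|` (B2 `|` (B3 `|` (B4 `|` (B5 `|` E n))))).
  have m5 : measurable (B5 `|` E n) by exact: measurableU.
  have m4 : measurable (B4 `|` (B5 `|` E n)) by exact: measurableU.
  have m3 : measurable (B3 `|` (B4 `|` (B5 `|` E n))) by exact: measurableU.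
  have m2 : measurable (B2 `|` (B3 `|` (B4 `|` (B5 `|` E n)))).
    exact: measurableU.
  split; first exact: measurableU.
  have := @fine_probabilityU_le _ _ _ P _ _ mB1 m2.
  have := @fine_probabilityU_le _ _ _ P _ _ mB2 m3.
  have := @fine_probabilityU_le _ _ _ P _ _ mB3 m4.
  have := @fine_probabilityU_le _ _ _ P _ _ mB4 m5.
  have := @fine_probabilityU_le _ _ _ P _ _ mB5 (mE n).
  by lra.
move=> w nB.
have nB1 : ~ B1 w by move=> ?; apply: nB; left.
have nB2 : ~ B2 w by move=> ?; apply: nB; right; left.
have nB3 : ~ B3 w by move=> ?; apply: nB; do 2 right; left.
have nB4 : ~ B4 w by move=> ?; apply: nB; do 3 right; left.
have N0M : N 0%N w <= M.
  by apply: contrapT => ?; apply: nB; do 4 right; left.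
have nE : ~ E n w by move=> ?; apply: nB; do 5 right.
have close := HE n w nE.
have fb : `|freq V b m w - F b| <= s / 8 by rewrite leNgt; apply/negP.
have fb' : `|freq V b' m w - F b'| <= s / 8 by rewrite leNgt; apply/negP.
have fM : `|freq N M m w - marg_cdf P (N 0%N) M| <= s / 8.
  by rewrite leNgt; apply/negP.
move: fb fb' fM; rewrite !ler_norml => /andP[_ fb] /andP[fb' _] /andP[fM _].
set U := _^-1 * _.
have mean_le (X Y Z : R) : X <= Y + (m.+1%:R - Z) ->
    m.+1%:R^-1 * X <= m.+1%:R^-1 * Y + (1 - m.+1%:R^-1 * Z).
  have m0 : 0 <= m.+1%:R^-1 :> R by rewrite invr_ge0.
  move=> /(ler_wpM2l m0); rewrite mulrDr mulrBr mulVf ?pnatr_eq0 //.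
(* On the left the rank is below (p - s/2) + s/8 + s/4 = p - s/8: the frequency deviation costs s/8,
   the indices beyond [M] at most s/4. On the right it is symmetrically above p + s/8. Both
   statements are thus false on the left and true on the right. *)
have [Va|aV] := ltP (V 0%N w) a.
  have h1 : F (V 0%N w) <= p - s
    by rewrite -Fa; apply: marg_cdf_le => //; exact: ltW.
  have h2 : V 0%N w + rho <= b by lra.
  have := mean_le _ _ _ (@rank_le_count R (V ^~ w) (Vh n ^~ w) (N ^~ w) M rho eta
    (ltW eta0) etaM close N0M b m.+1 h2).
  rewrite -/U -/(freq V b m w) -/(freq N M m w) => h3.
  split=> [pU|pF]; exfalso; lra.
have cV : c < V 0%N w.
  rewrite ltNge; apply/negP => Vc; apply: nB1; split => //=.
  by apply/negP; rewrite -leNgt.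
have h1 : p + s <= F (V 0%N w)
  by rewrite -Fc; apply: marg_cdf_le => //; exact: ltW.
have h2 : b' <= V 0%N w - rho by lra.
have := mean_le _ _ _ (@count_le_rank R (V ^~ w) (Vh n ^~ w) (N ^~ w) M rho eta
  (ltW eta0) etaM close N0M b' m.+1 h2).
rewrite -/U -/(freq V b' m w) -/(freq N M m w) => h3.
split=> _; lra.
Unshelve. all: by end_near. Qed.

End rank_consistency.

Lemma gen_sigma_measurable (R : realType) (dd : measure_display)
    (T : measurableType dd) (I : Type) (S : set I) (X : I -> T -> R)
    (B : set T) : (forall i, measurable_fun setT (X i)) ->
  gen_sigma S X B -> measurable B.
Proof.
move=> mX; apply: smallest_sub; first exact: sigma_algebra_measurable.
move=> _ [s _ [C mC <-]]; rewrite -[X in measurable X]setTI; exact: mX.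
Qed.

(** * Application to the autoregressive model *)

Unset Implicit Arguments.

Theorem theorem6 (R : realType) (dd : measure_display) (T : measurableType dd)
  (P : probability T R)
  (d : nat) (phi : 'cV[R]_d)
  (eps Y : int -> T -> R)
  (t : int) (h : nat) (p : R)
  (phihat : nat -> T -> 'cV[R]_d) :
  (0 < d)%N ->
  (* roots of 1 - sum phi_i z^i lie outside the closed unit disk *)
  (forall z : R[i], `|z| <= 1 -> ar_poly_eval phi z != 0) ->
  (* iid innovations with a Lebesgue density and a finite delta-moment *)
  (forall s, measurable_fun setT (eps s)) ->
  mutually_independent P eps ->
  identically_distributed P eps 0 ->
  has_lebesgue_density P (eps 0) ->
  (exists delta : R, 0 < delta /\
     (\int[P]_w ((`|eps 0 w| `^ delta)%:E) < +oo)%E) ->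
  (* Y is the stationary solution Y_s = sum_{i>=0} a_i eps_{s-i} of the AR(d) equation *)
  (forall s, measurable_fun setT (Y s)) ->
  (forall s, {ae P, forall w,
     Y s w = \sum_(j < d) phi j 0 * Y (s - (j.+1)%:Z) w + eps s w}) ->
  (forall s, {ae P, forall w,
     (fun N : nat => \sum_(i < N) ma_coef phi i * eps (s - (i : nat)%:Z) w)
       @ \oo --> Y s w}) ->
  (* eps_s independent of sigma{Y_u, u <= s-1} *)
  (forall s, indep_of_sigma P (eps s) (gen_sigma [set u | u <= s - 1] Y)) ->
  (* forecast horizon and level *)
  (0 < h)%N -> 0 < p < 1 ->
  (* phihat(n) is an estimator based on the observations Y_t, ..., Y_{t-n+1} *)
  (forall (n : nat) (i : 'I_d) (C : set R), measurable C ->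
     gen_sigma [set u | t - (n : int) + 1 <= u <= t] Y
       ((fun w => phihat n w i 0) @^-1` C)) ->
  (* phihat(n) -> phi in probability *)
  (forall (i : 'I_d) (e : R), 0 < e ->
     (fun n => P [set w | e < `|phihat n w i 0 - phi i 0|]) @ \oo --> 0%E) ->
  let Z := fun (k : int) (w : T) => \col_(j < d) Y (k - (j : nat)%:Z) w in
  (* Yhat_{t+h}(phi) = phi(h)^T Z_t *)
  let Yhat := fun w => ((phi_h phi h)^T *m Z t w) 0 0 in
  (* Uhat_{t+h} computed from the estimator phihat(n) *)
  let Uhat := fun (n : nat) (w : T) =>
    let ph := phi_h (phihat n w) h in
    ((n - d + 1)%:R)^-1 *
      \sum_(k < (n - d + 1)%N)
        (((ph^T *m Z (t - (k : nat)%:Z) w) 0 0 <= (ph^T *m Z t w) 0 0)%R)%:R in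
  (* U*_{t+h} = P_Z(phi(h)^T Z <= Yhat_{t+h}(phi)), Z an independent copy of Z_t *)
  let Ustar := fun w => fine (P [set w' | Yhat w' <= Yhat w]) in
  let q := gen_inverse (marg_cdf P (Y t)) p in
  let Aev := [set w | q <= Y (t + h%:Z) w] in
  has_lebesgue_density P Yhat ->
  {for q, continuous (marg_cdf P (Y t))} ->
  ((fun n => P [set w | p <= Uhat n w]) @ \oo --> (1 - p)%:E /\
   P Aev = (1 - p)%:E) /\
  ((fun n => cond_prob P Aev [set w | p <= Uhat n w]) @ \oo -->
     cond_prob P Aev [set w | p <= Ustar w]).
Proof.
move=> d0 _ meps ind idd _ _ mY _ YMA _ _ p01 phihat_obs phihat_cvg
  Z Yhat Uhat Ustar q Aev dens cq.
have /andP[p0 p1] := p01.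
have YE s : {ae P, forall w, Y s w = ma_limit phi (past_path eps s w)}.
  apply: filterS (YMA s) => w Yw.
  by rewrite (@ma_limitE R d phi (past_path eps s w) _ Yw).
have mphihat n i : measurable_fun setT (fun w => phihat n w i 0).
  move=> _ C mC; rewrite setTI.
  exact: gen_sigma_measurable mY (phihat_obs n i C mC).
(* [V k] and [Vh n k] are the projections of Z_{t-k} on the true and on the estimated coefficients.
   [N k] is the l1 norm of Z_{t-k}, dual to the entrywise bound on the coefficient error. *)
pose V (k : nat) w := \sum_j phi_h phi h j 0 * Y (t - k%:Z - (j : nat)%:Z) w.
pose N (k : nat) w := \sum_(j < d) `|Y (t - k%:Z - (j : nat)%:Z) w|.
pose Vh (n k : nat) w :=
  \sum_j phi_h (phihat n w) h j 0 * Y (t - k%:Z - (j : nat)%:Z) w.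
have mV k : measurable_fun setT (V k).
  by apply: measurable_sum => j; apply: measurable_funM.
have mN k : measurable_fun setT (N k).
  apply: measurable_sum => j.
  exact: (measurableT_comp (@normr_measurable R setT)).
have mVh n k : measurable_fun setT (Vh n k).
  apply: measurable_sum => j; apply: measurable_funM => //.
  exact: measurable_phi_h.
have dotE (c : 'cV[R]_d) k w :
    (c^T *m Z (t - k%:Z) w) 0 0 = \sum_j c j 0 * Y (t - k%:Z - (j : nat)%:Z) w.
  by rewrite mxE; apply: eq_bigr => j _; rewrite !mxE.
have YhatE : Yhat = V 0%N.
  by apply/funext => w; rewrite /Yhat -[in Z t w](subr0 t) dotE.
have UhatE n w : Uhat n w = (n - d).+1%:R^-1 *
    \sum_(k < (n - d).+1) (Vh n k w <= Vh n 0%N w)%R%:R.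
  rewrite /Uhat addn1; congr (_ * _); apply: eq_bigr => k _.
  by rewrite -[in Z t w](subr0 t) !dotE.
have noatom x : P (V 0%N @^-1` [set x]) = 0%E.
  by rewrite -YhatE; exact: density_atomless.
have Yshift k : {ae P, forall w, forall j : nat,
    Y (t - k%:Z - j%:Z) w =
    ma_limit phi (path_shift j (past_path eps (t - k%:Z) w))}.
  apply: ae_foralln => j; apply: filterS (YE (t - k%:Z - j%:Z)) => w ->.
  by rewrite past_path_shift.
have mgY (j : nat) : measurable_fun setT
    (fun x : path_space R => ma_limit phi (path_shift j x)).
  apply: measurableT_comp; first exact: measurable_ma_limit.
  exact: measurable_path_shift.
have llnV (b eta : R) : 0 < eta ->
    (fun n => fine (P [set w | eta < `|n.+1%:R^-1 *
     \sum_(k < n.+1) (V k w <= b)%R%:R - marg_cdf P (V 0%N) b|]))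
    @ \oo --> (0 : R).
  apply: (@empirical_cdf_cvg _ _ _ P eps meps ind idd t (fun x =>
    \sum_j phi_h phi h j 0 * ma_limit phi (path_shift j x))) => //.
    by apply: measurable_sum => j; apply: measurable_funM.
  move=> k; apply: filterS (Yshift k) => w Yw.
  by apply: eq_bigr => j _; rewrite Yw.
have llnN (b eta : R) : 0 < eta ->
    (fun n => fine (P [set w | eta < `|n.+1%:R^-1 *
     \sum_(k < n.+1) (N k w <= b)%R%:R - marg_cdf P (N 0%N) b|]))
    @ \oo --> (0 : R).
  apply: (@empirical_cdf_cvg _ _ _ P eps meps ind idd t (fun x =>
    \sum_(j < d) `|ma_limit phi (path_shift j x)|)) => //.
    apply: measurable_sum => j.
    exact: (measurableT_comp (@normr_measurable R setT)).
  move=> k; apply: filterS (Yshift k) => w Yw.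
  by apply: eq_bigr => j _; rewrite Yw.
have consistent (eta : R) : 0 < eta ->
    exists E : nat -> set T, [/\ forall n, measurable (E n),
      (fun n => fine (P (E n))) @ \oo --> (0 : R) &
      forall n w, ~ E n w -> forall k, `|Vh n k w - V k w| <= eta * N k w].
  move=> eta0; have [delta delta0 near_phi] := @phi_h_near R d phi h eta eta0.
  pose E1 n i := [set w | delta < `|phihat n w i 0 - phi i 0|].
  have mE1 n i : measurable (E1 n i) by exact: measurable_lt_dist.
  (* Off this finite union all entries of phihat are within [delta] of phi, which [phi_h_near] turns
     into an error of at most [eta] in each forecast coefficient. *)
  exists (fun n => \big[setU/set0]_(i < d) E1 n i); split.
  - by move=> n; exact: bigsetU_measurable.
  - have sum0 : (fun n => \sum_(i < d) fine (P (E1 n i))) @ \oo -->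
        \sum_(i < d) (0 : R).
      apply: cvg_big => [|i _]; first exact: add_continuous.
      by apply: fine_cvg; exact: phihat_cvg.
    rewrite big1 // in sum0.
    apply: (squeeze_cvgr _ (cvg_cst 0) sum0); apply: nearW => n.
    by rewrite fine_probability_ge0 fine_probability_bigsetU_le.
  - move=> n w; rewrite -bigcup_seq => nE k.
    have close i : `|phihat n w i 0 - phi i 0| <= delta.
      rewrite leNgt; apply/negP => ?; apply: nE; exists i => //=.
      by rewrite mem_index_enum.
    rewrite /Vh /V /N -sumrB mulr_sumr; apply: le_trans (ler_norm_sum _ _ _) _.
    apply: ler_sum => j _; rewrite -mulrBl normrM ler_wpM2r //.
    exact: near_phi.
pose x := gen_inverse (marg_cdf P (V 0%N)) p.
have Fx : marg_cdf P (V 0%N) x = p.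
  exact: marg_cdf_gen_inverse_atomless.
(* [Ustar] is the distribution function of [V 0] evaluated at [V 0]; it stays below p strictly left
   of the quantile [x] and is at least p from [x] on. *)
have GE : [set w | p <= Ustar w] = ~` [set w | V 0%N w < x].
  rewrite /Ustar YhatE; apply/seteqP; split => w /= H.
    move=> /(@marg_cdf_lt_gen_inverse _ _ _ P _ (mV 0%N) _ p01).
    by rewrite ltNge H.
  rewrite -Fx; apply: marg_cdf_le => //; rewrite leNgt; exact/negP.
have mVx : measurable [set w | V 0%N w < x] by exact: measurable_lt_cst.
have mG : measurable [set w | p <= Ustar w].
  by rewrite GE; exact: measurableC.
have mU n : measurable_fun setT (Uhat n).
  rewrite (funext (UhatE n)).
  apply: measurable_funM => //; apply: measurable_sum => k.
  exact: measurable_le_indicator.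
have mGn n : measurable [set w | p <= Uhat n w].
  by apply: measurable_le_fun.
have mA : measurable Aev by exact: measurable_le_fun.
have PG : fine (P [set w | p <= Ustar w]) = 1 - p.
  rewrite GE -setTD fine_probabilityD // probability_setT /=.
  by rewrite prob_lt_atomless // Fx.
have PA : P Aev = (1 - p)%:E.
  have -> : Aev = ~` [set w | Y (t + h%:Z) w < q].
    by rewrite /Aev; apply/seteqP; split => w /=; rewrite leNgt => /negP.
  have mYq s : measurable [set w | Y s w < q] by exact: measurable_lt_cst.
  rewrite -EFin_probability -?setTD; last exact: measurableD.
  rewrite fine_probabilityD // probability_setT /=; congr (1 - _)%:E.
  pose B := [set y : path_space R | ma_limit phi y < q].
  have mB : measurable B.
    by apply: measurable_lt_cst; exact: measurable_ma_limit.
  have PB s : P [set w | Y s w < q] = past_law P eps meps s B.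
    rewrite past_lawE; apply: ae_eq_probability => //.
      exact: measurable_past_preimage.
    by apply: filterS (YE s) => w; rewrite /B /= => ->.
  rewrite PB (@past_law_stationary _ _ _ P eps meps ind idd _ t B mB) -PB.
  exact: marg_cdf_gen_inverse_continuous.
have cvgI (A : set T) : measurable A ->
    (fun n => fine (P (A `&` [set w | p <= Uhat n w]))) @ \oo -->
    fine (P (A `&` [set w | p <= Ustar w])).
  move=> mA'; apply/cvgrPdist_le => e e0.
  have := @rank_threshold_consistency _ _ _ P V N Vh d p mV mN noatom p01
    llnV llnN consistent e e0.
  apply: filterS => n [B [mB PB] HB]; apply: le_trans PB.
  apply: probability_dist_le => // w nB /=.
  by rewrite UhatE /Ustar YhatE; have [? ?] := HB w nB; split.
have cvgG : (fun n => fine (P [set w | p <= Uhat n w])) @ \oo --> 1 - p.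
  rewrite -PG; have := cvgI setT measurableT; rewrite setTI.
  by under eq_fun do rewrite setTI.
split; first split=> //.
- apply: cvg_EFin => //; apply: nearW => n; exact: fin_num_measure.
(* Numerator and denominator converge separately; the limit 1 - p of the denominator is nonzero
   because p < 1. *)
- rewrite /cond_prob PG; apply: cvgM; first exact: cvgI.
  by apply: cvgV => //; rewrite subr_eq0 gt_eqF.
Qed.
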